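(* Let $(X,\mathcal{O}(X))$ be a measurable space, $\mathcal{A}$ a unital $C^*$-algebra and $\mathcal{H}$ a Hilbert space. The set $Ins_{\mathcal{H}}(X,\mathcal{A})$ of all CP instruments $\mathcal{I}:\mathcal{O}(X)\to CP(\mathcal{A},\mathcal{B}(\mathcal{H}))$ is complete with respect to the total variation metric.
   Context: $CP(\mathcal{A},\mathcal{B}(\mathcal{H}))$ is the set of completely positive linear maps $\mathcal{A}\to\mathcal{B}(\mathcal{H})$. A CP instrument is a map $\mathcal{I}:\mathcal{O}(X)\to CP(\mathcal{A},\mathcal{B}(\mathcal{H}))$ such that for all $h,k\in\mathcal{H}$, $a\in\mathcal{A}$ the set function $A\mapsto\langle h,\mathcal{I}(A)(a)k\rangle$ is a complex measure. For $h,k\in\mathcal{H}$, $\mathcal{I}_{h,k}:\mathcal{O}(X)\to\mathcal{A}^*$, $\mathcal{I}_{h,k}(A)(a)=\langle h,\mathcal{I}(A)(a)k\rangle$, is an $\mathcal{A}^*$-valued vector measure. For a vector measure $\mu$, its total variation is $|\mu|(A)=\sup\{\sum_i\|\mu(E_i)\|:\{E_1,\dots,E_n\}\text{ a measurable partition of }A\}$. The total variation norm is $$\|\mathcal{I}\|_{\mathrm{TV}}=\sup_{\|h\|=\|k\|=1}|\mathcal{I}_{h,k}|(X),$$ and the total variation metric is the induced metric $d(\mathcal{I},\mathcal{J})=\|\mathcal{I}-\mathcal{J}\|_{\mathrm{TV}}=\sup_{\|h\|=\|k\|=1}|\mathcal{I}_{h,k}-\mathcal{J}_{h,k}|(X)$.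 *)

(* Defs.v *)
From HB Require Import structures.
From mathcomp Require Import all_boot all_order all_algebra sesquilinear.
From mathcomp Require Import complex.
From mathcomp Require Import all_classical all_reals.
From mathcomp Require Import ereal topology normedtype sequences.
From mathcomp Require Import measure.

Set Implicit Arguments.
Unset Strict Implicit.
Unset Printing Implicit Defensive.

Import Order.TTheory GRing.Theory Num.Theory.
Import numFieldNormedType.Exports.

Local Open Scope classical_set_scope.
Local Open Scope ring_scope.

HB.mixin Record CompleteNormedModule_isHilbert (R : realType) H
    of CompleteNormedModule R[i] H := {
  inner_form : {dot H for @Num.conj R[i]} ;
  normr_inner_form : forall h : H, `|h| ^+ 2 = inner_form h h
}.

#[short(type="hilbertType")]
HB.structure Definition Hilbert (R : realType) :=
  {H of CompleteNormedModule R[i] H & CompleteNormedModule_isHilbert R H}.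

(* `inner_form` is linear in its first argument, as in the library; the pairing
   below is linear in the second one, so that `a |-> inner h (phi a k)` is
   linear whenever `phi` is. *)
Definition inner (R : realType) (H : hilbertType R) (h k : H) : R[i] :=
  inner_form k h.

(* The hierarchy has no join of normed modules with rings (`numDomainType`
   inherits from both), so the product is a bilinear operation of the mixin
   instead of a ring structure. *)
HB.mixin Record CompleteNormedModule_isCstarAlgebra (R : realType) A
    of CompleteNormedModule R[i] A := {
  cone : A ;
  cmul : {bilinear A -> A -> A} ;
  cmulA : associative cmul ;
  cmul1a : left_id cone cmul ;
  cmula1 : right_id cone cmul ;
  star : A -> A ;
  starD : {morph star : a b / a + b} ;
  starZ : forall (c : R[i]) a, star (c *: a) = Num.conj c *: star a ;
  starM : forall a b, star (cmul a b) = cmul (star b) (star a) ;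
  starK : involutive star ;
  normr_cmul_le : forall a b : A, `|cmul a b| <= `|a| * `|b| ;
  normr_cmul_star : forall a : A, `|cmul (star a) a| = `|a| ^+ 2
}.

#[short(type="cstarAlgType")]
HB.structure Definition CstarAlgebra (R : realType) :=
  {A of CompleteNormedModule R[i] A & CompleteNormedModule_isCstarAlgebra R A}.

Section CompletelyPositive.
Context {R : realType} {A : cstarAlgType R} {H : hilbertType R}.

(* The entries of B^* B in the C*-algebra of n x n matrices over A. *)
Definition gram_mx n (B : 'M[A]_n) : 'M[A]_n :=
  \matrix_(i, j) \sum_k cmul (star (B k i)) (B k j).

Definition cstar_pos_mx n (M : 'M[A]_n) := exists B : 'M[A]_n, M = gram_mx B.

(* Positivity of an n x n matrix of operators as an operator on the n-fold
   direct sum of H. *)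
Definition pos_op_mx n (T : 'I_n -> 'I_n -> H -> H) :=
  forall h : 'I_n -> H, 0 <= \sum_i \sum_j inner (h i) (T i j (h j)).

Definition bounded_op (T : H -> H) := linear T /\ continuous T.

Definition completely_positive (phi : A -> H -> H) :=
  [/\ forall a, bounded_op (phi a),
      linear phi &
      forall n (M : 'M[A]_n), cstar_pos_mx M -> pos_op_mx (fun i j => phi (M i j))].

End CompletelyPositive.

Section Instruments.
Context {R : realType} {X : Type}.

(* Here and below, `OX` is the sigma-algebra, and `E : OX` ranges over its
   members. *)
Definition complex_measure (OX : set (set X)) (mu : OX -> R[i]^o) :=
  forall (F : nat -> OX) (U : OX),
    trivIset setT (fun n => \val (F n)) ->
    \val U = \bigcup_n \val (F n) ->
    (\sum_(0 <= i < n) mu (F i)) @[n --> \oo] --> mu U.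

Record cp_instrument (OX : set (set X)) (A : cstarAlgType R)
    (H : hilbertType R) := CPInstrument {
  instrument :> OX -> A -> H -> H ;
  instrument_cp : forall E, completely_positive (instrument E) ;
  instrument_measure : forall (h k : H) (a : A),
    complex_measure (fun E => inner h (instrument E a k))
}.

Definition dual_norm (A : cstarAlgType R) (f : A -> R[i]) : \bar R :=
  ereal_sup [set (Normc.normc (f a))%:E | a in [set a : A | `|a| <= 1]].

Definition total_variation (OX : set (set X)) (A : cstarAlgType R)
    (mu : OX -> A -> R[i]) (U : set X) : \bar R :=
  ereal_sup [set v | exists (n : nat) (E : 'I_n -> OX),
    partition setT (fun i => \val (E i)) U /\
    v = (\sum_(i < n) dual_norm (mu (E i)))%E].

Section TVMetric.
Context {OX : set (set X)} {A : cstarAlgType R} {H : hilbertType R}.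

Definition matrix_coef (I : OX -> A -> H -> H) (h k : H) : OX -> A -> R[i] :=
  fun E a => inner h (I E a k).

(* The maximum with 0 matters only for H = 0, where no unit vector exists and
   `ereal_sup set0 = -oo`. *)
Definition tv_norm (I : OX -> A -> H -> H) : \bar R :=
  Order.max 0%E (ereal_sup [set total_variation (matrix_coef I h k) setT |
    h in [set h : H | `|h| = 1] & k in [set k : H | `|k| = 1]]).

Definition tv_dist (I J : cp_instrument OX A H) : \bar R :=
  tv_norm (fun E a h => I E a h - J E a h).

Lemma dual_norm_add (f g : A -> R[i]) :
  (dual_norm (fun a => f a + g a)%R <= dual_norm f + dual_norm g)%E.
Proof.
apply: ge_ereal_sup => _ [a a1 <-].
apply: (@le_trans _ _ ((Normc.normc (f a))%:E + (Normc.normc (g a))%:E)%E).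
  by rewrite -EFinD lee_fin le_normcD.
by apply: leeD; apply: ereal_sup_ubound; exists a.
Qed.

Lemma total_variation_add (mu nu : OX -> A -> R[i]) (U : set X) :
  (total_variation (fun E a => mu E a + nu E a)%R U <=
   total_variation mu U + total_variation nu U)%E.
Proof.
apply: ge_ereal_sup => _ [n [E [EU ->]]].
apply: (@le_trans _ _ (\sum_(i < n) (dual_norm (mu (E i)) + dual_norm (nu (E i))))%E).
  by apply: lee_sum => i _; exact: dual_norm_add.
by rewrite big_split/=; apply: leeD; apply: ereal_sup_ubound; exists n, E.
Qed.

Lemma tv_norm_add (I J : OX -> A -> H -> H) :
  (tv_norm (fun E a h => I E a h + J E a h)%R <= tv_norm I + tv_norm J)%E.
Proof.
rewrite /tv_norm ge_max; apply/andP; split.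
  by apply: adde_ge0; rewrite le_max lexx.
apply: ge_ereal_sup => _ [h h1 [k k1 <-]].
have -> : matrix_coef (fun E a h => I E a h + J E a h) h k =
    (fun E a => matrix_coef I h k E a + matrix_coef J h k E a).
  by apply/funext => E; apply/funext => a; rewrite /matrix_coef /inner linearDl.
apply: (le_trans (total_variation_add _ _ _)); apply: leeD;
  by rewrite le_max; apply/orP; right; apply: ereal_sup_ubound; exists h => //; exists k.
Qed.

Lemma tv_dist_xx (I : cp_instrument OX A H) : tv_dist I I = 0%E.
Proof.
apply/eqP; rewrite eq_le; apply/andP; split; last by rewrite le_max lexx.
rewrite /tv_dist /tv_norm ge_max lexx /=.
apply: ge_ereal_sup => _ [h _ [k _ <-]].
apply: ge_ereal_sup => _ [n [E [_ ->]]].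
apply: sume_le0 => i _; apply: ge_ereal_sup => _ [a _ <-].
by rewrite /matrix_coef /inner subrr linear0l Normc.normc0.
Qed.

Lemma tv_dist_sym (I J : cp_instrument OX A H) : tv_dist I J = tv_dist J I.
Proof.
rewrite /tv_dist /tv_norm; congr (Order.max _ (ereal_sup _)).
apply/seteqP; split => _ [h h1 [k k1 <-]]; exists h => //; exists k => //;
  congr ereal_sup; apply/seteqP; split => _ [n [E [EU ->]]];
  exists n, E; split => //; apply: eq_bigr => i _; congr ereal_sup;
  apply/seteqP; split => _ [a a1 <-]; exists a => //;
  by rewrite /matrix_coef /inner -opprB linearNl normcN.
Qed.

Lemma tv_dist_triangle (J I K : cp_instrument OX A H) :
  (tv_dist I K <= tv_dist I J + tv_dist J K)%E.
Proof.
rewrite /tv_dist; set IJ := fun E a h => I E a h - J E a h.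
set JK := fun E a h => J E a h - K E a h.
suff -> : (fun E a h => I E a h - K E a h) =
    (fun E a h => IJ E a h + JK E a h) by exact: tv_norm_add.
apply/funext => E; apply/funext => a; apply/funext => h.
by rewrite /IJ /JK addrA subrK.
Qed.

Definition tv_ball (I : cp_instrument OX A H) (e : R) : set (cp_instrument OX A H) :=
  [set J | (tv_dist I J < e%:E)%E].

Lemma tv_ball_center I (e : R) : 0 < e -> tv_ball I e I.
Proof. by move=> e0; rewrite /tv_ball/= tv_dist_xx lte_fin. Qed.

Lemma tv_ball_sym I J (e : R) : tv_ball I e J -> tv_ball J e I.
Proof. by rewrite /tv_ball/= tv_dist_sym. Qed.

Lemma tv_ball_triangle I J K (e1 e2 : R) :
  tv_ball I e1 J -> tv_ball J e2 K -> tv_ball I (e1 + e2) K.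
Proof.
move=> IJ JK; rewrite /tv_ball/=; apply: (le_lt_trans (tv_dist_triangle J _ _)).
by rewrite EFinD; exact: lteD.
Qed.

HB.instance Definition _ := gen_eqMixin (cp_instrument OX A H).
HB.instance Definition _ := gen_choiceMixin (cp_instrument OX A H).
HB.instance Definition _ :=
  hasNbhs.Build (cp_instrument OX A H) (nbhs_ (entourage_ tv_ball)).
HB.instance Definition _ := @Nbhs_isPseudoMetric.Build R (cp_instrument OX A H)
  (entourage_ tv_ball) erefl tv_ball tv_ball_center tv_ball_sym tv_ball_triangle
  erefl.

Lemma zero_cp (E : OX) : completely_positive (fun (_ : A) (_ : H) => 0 : H).
Proof.
split=> [a||n M _ h].
- by split; [move=> c u v; rewrite scaler0 addr0 | move=> x; exact: cvg_cst].
- by move=> c u v; apply/funext => h; rewrite /= [RHS]addr0 [RHS]scaler0.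
- by apply: sumr_ge0 => i _; apply: sumr_ge0 => j _; rewrite /inner linear0l.
Qed.

Lemma zero_measure (h k : H) (a : A) :
  complex_measure (fun _ : OX => inner h (0 : H)).
Proof.
move=> F U _ _; rewrite /inner linear0l.
under eq_fun do rewrite big1 //.
exact: cvg_cst.
Qed.

HB.instance Definition _ := isPointed.Build (cp_instrument OX A H)
  (CPInstrument zero_cp zero_measure).

End TVMetric.

End Instruments.

(* Main.v *)
Require Import Defs.
From mathcomp Require Import all_boot all_order all_algebra complex.
From mathcomp Require Import all_classical all_reals.
From mathcomp Require Import ereal topology normedtype sequences measure.
From mathcomp Require Import sesquilinear ring.
Import Order.TTheory GRing.Theory Num.Theory.
Import numFieldNormedType.Exports.
Set Implicit Arguments.
Unset Strict Implicit.
Unset Printing Implicit Defensive.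

Local Open Scope classical_set_scope.
Local Open Scope ring_scope.

(** The total variation distance dominates the pointwise distance of two
    instruments: evaluating the variation on the partition of X into E and its
    complement gives
    |I E a k - J E a k| <= tv_dist I J * |a| * |k|,
    uniformly in the set E ([normr_le_tv_dist]).  So along a Cauchy filter of
    instruments the vectors I E a k form a Cauchy filter of H, and the
    completeness of H provides a limit [limit_map E a k].

    This limit is an instrument.  Linearity and complete positivity are closed
    conditions involving finitely many vectors, so they pass to a pointwise
    limit.  Continuity and countable additivity need more: by the estimate
    above the convergence is uniform on bounded sets of vectors and over all
    sets E.  Uniformity over E makes I V -> I U, for V the finite unions
    exhausting U, survive the passage to the limit, once finite additivity of
    the limit has turned its partial sums into its values on finite unions.

    The convergence also holds in total variation.  If tv_dist I J <= e for all
    J far along the filter, then for a partition into n sets the variation sum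
    of I - lim is at most that of I - J, hence at most e, plus n times the
    uniform distance from J to the limit; J is chosen after n, so the extra term
    is arbitrarily small ([tv_dist_limit_le]).  The Cauchy property makes this
    apply, for every e > 0, to all I far along the filter. *)

(** * Limits in normed modules *)

Section NormedModuleLimits.

Lemma cvg_le_dist (K : numFieldType) (V W : normedModType K) (T : Type)
    (F : set_system T) (FF : Filter F) (f : T -> V) (g : T -> W) (x : V) (y : W)
    (C : K) :
  0 <= C -> (forall t, `|y - g t| <= C * `|x - f t|) ->
  f t @[t --> F] --> x -> g t @[t --> F] --> y.
Proof.
move=> C0 gf fx; apply/cvgrPdist_le => e e0.
have C1 : 0 < C + 1 by rewrite ltr_wpDl.
have := (@cvgrPdist_le _ _ _ _ FF f x).1 fx (e / (C + 1)) (divr_gt0 e0 C1).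
apply: filterS => t ft; apply: (le_trans (gf t)).
apply: (@le_trans _ _ ((C + 1) * `|x - f t|)).
  by rewrite ler_wpM2r // lerDl.
by rewrite mulrC -ler_pdivlMr.
Qed.

(** The order of R[i] is partial; its positive cone is closed because it is the
    set where the identity agrees with the norm, and both are continuous. *)
Lemma cvg_ge0_complex (R : realType) (T : Type) (F : set_system T)
    (FF : ProperFilter F) (f : T -> R[i]^o) (l : R[i]^o) :
  (\forall t \near F, 0 <= f t) -> f t @[t --> F] --> l -> 0 <= l.
Proof.
move=> f0 fl.
have norm_f : {near F, (fun t => `|f t| : R[i]^o) =1 f}.
  by apply: filterS f0 => t /ger0_norm.
have fnl : f t @[t --> F] --> (`|l| : R[i]^o).
  exact: cvg_trans (near_eq_cvg norm_f) (cvg_norm fl).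
by rewrite (cvg_unique (@norm_hausdorff _ _) fl fnl).
Qed.

(** Radii are reals for instruments, but positive elements of R[i] for vectors:
    the bound `e` on vectors has to be reached from a real `d`. *)
Lemma ex_real_radius (R : realType) (e c : R[i]) : 0 < e -> 0 <= c ->
  exists2 d : R, 0 < d & d%:C%C * c <= e.
Proof.
move=> e0 c0; have c1 : 0 < c + 1 by rewrite ltr_wpDl.
have d0 : 0 < e / (c + 1) by rewrite divr_gt0.
(* A positive complex number is real; `c + 1` replaces `c`, which may be 0. *)
have dE : (complex.Re (e / (c + 1)))%:C%C = e / (c + 1).
  by rewrite RRe_real// gtr0_real.
exists (complex.Re (e / (c + 1))); first by rewrite -ltcR dE.
by rewrite dE mulrAC ler_pdivrMr// ler_wpM2l ?lerDl// ltW.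
Qed.

End NormedModuleLimits.

(** * The inner product *)

Section HilbertSpace.
Context {R : realType} {H : hilbertType R}.
Implicit Types (h k v : H).

Lemma innerD h k v : inner h (k + v) = inner h k + inner h v.
Proof. by rewrite /inner linearDl. Qed.

Lemma innerB h k v : inner h (k - v) = inner h k - inner h v.
Proof. by rewrite /inner linearBl. Qed.

Lemma innerZ (c : R[i]) h k : inner h (c *: k) = c * inner h k.
Proof. by rewrite /inner linearZl_LR. Qed.

Lemma inner0 h : inner h 0 = 0.
Proof. by rewrite /inner linear0l. Qed.

Lemma innerC h k : inner h k = (inner k h)^*.
Proof. by rewrite /inner hermC expr0 mul1r. Qed.

Lemma inner_normr h : inner h h = `|h| ^+ 2.
Proof. by rewrite normr_inner_form. Qed.

(** Cauchy-Schwarz: the vector `|h|^2 k - <h, k> h`, a multiple of the component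
    of `k` orthogonal to `h`, has a nonnegative squared norm. *)
Lemma normr_inner_le h k : `|inner h k| <= `|h| * `|k|.
Proof.
have [->|h0] := eqVneq h 0.
  by rewrite innerC inner0 rmorph0 !normr0 mul0r.
have h1 : 0 < `|h| by rewrite normr_gt0.
set c := inner h k.
have : 0 <= `| `|h| ^+ 2 *: k - c *: h| ^+ 2 by rewrite exprn_ge0.
rewrite -(inner_normr (_ - _)) innerB !innerZ.
have hB u : inner (`|h| ^+ 2 *: k - c *: h) u =
    `|h| ^+ 2 * inner k u - c^* * inner h u.
  rewrite innerC innerB !innerZ rmorphB !rmorphM/= -!innerC.
  by rewrite !(geC0_conj (normr_ge0 h)) expr2.
rewrite !hB !inner_normr (innerC k h) -/c.
have -> : `|h| ^+ 2 * (`|h| ^+ 2 * `|k| ^+ 2 - c^* * c) -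
   c * (`|h| ^+ 2 * c^* - c^* * `|h| ^+ 2) =
   `|h| ^+ 2 * ((`|h| * `|k|) ^+ 2 - c * c^*) by ring.
rewrite pmulr_rge0 ?exprn_gt0// subr_ge0 -normCK.
by rewrite ler_pXn2r ?nnegrE ?mulr_ge0.
Qed.

Lemma normr_le_inner (c : R[i]) v : 0 <= c ->
  (forall h, `|h| = 1 -> `|inner h v| <= c) -> `|v| <= c.
Proof.
move=> c0 hc; have [->|v0] := eqVneq v 0; first by rewrite normr0.
have v1 : `|v| != 0 by rewrite normr_eq0.
(* The supremum over unit vectors `h` is attained at `v / |v|`. *)
have := hc (`|v|^-1 *: v).
rewrite normrZ normfV normr_id mulVf// => /(_ erefl).
rewrite innerC innerZ inner_normr expr2 mulKf// norm_conjC.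
by rewrite normr_id.
Qed.

Lemma cvg_inner (T : Type) (F : set_system T) (FF : Filter F) (f : T -> H) h k :
  f t @[t --> F] --> k ->
  (inner h (f t) : R[i]^o) @[t --> F] --> (inner h k : R[i]^o).
Proof.
apply: (@cvg_le_dist R[i] H R[i]^o T F FF f _ k _ `|h|) => // t.
by rewrite -innerB normr_inner_le.
Qed.

End HilbertSpace.

(** * Complex measures *)

Section ComplexMeasures.
Context {R : realType} {X : Type} {OX : set (set X)}.
Hypothesis sigmaOX : sigma_algebra setT OX.

(** A convergent series with constant terms has terms 0. *)
Lemma complex_measure_set0 (mu : OX -> R[i]^o) (E : OX) :
  complex_measure mu -> \val E = set0 -> mu E = 0.
Proof.
move=> mu_meas E0.
have /cvgP/cvg_series_cvg_0 : (series (fun=> mu E)) @ \oo --> mu E.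
  apply: (mu_meas (fun=> E) E); first by rewrite E0; exact: trivIset_set0.
  by rewrite E0 bigcup0.
by move/(cvg_unique (@norm_hausdorff _ _) (cvg_cst (mu E))).
Qed.

(** Finite additivity.  The union `U` does not depend on `mu`, so that one set
    serves all the measures of a family and, by continuity, their limit. *)
Lemma complex_measure_finite_union (F : nat -> OX) (n : nat) :
  exists2 U : OX, \val U = \bigcup_(i < n) \val (F i) &
   forall mu : OX -> R[i]^o, complex_measure mu ->
     trivIset setT (fun i => \val (F i)) ->
     mu U = \sum_(0 <= i < n) mu (F i).
Proof.
have [O0 _ Ocup] := sigmaOX.
pose O : OX := SigSub (mem_set O0).
pose G i := if (i < n)%N then F i else O.
have GU : OX (\bigcup_i \val (G i)) by apply: Ocup => i; exact/set_mem/valP.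
have GF : \bigcup_i \val (G i) = \bigcup_(i < n) \val (F i).
  apply/seteqP; split => x [i /= Hi xi].
    by move: xi; rewrite /G; case: ifP => // ni xi; exists i.
  by exists i => //; rewrite /G Hi.
exists (SigSub (mem_set GU)) => // mu mu_meas tF.
have tG : trivIset setT (fun i => \val (G i)).
  apply/trivIsetP => i j _ _ ij; rewrite /G.
  case: ifP => _; last by rewrite set0I.
  case: ifP => _; last by rewrite setI0.
  by move/trivIsetP : tF; exact.
(* The partial sums along `G` are constant from rank `n` on. *)
have GUlim := mu_meas G (SigSub (mem_set GU)) tG erefl.
apply: (cvg_unique (@norm_hausdorff _ _) GUlim).
apply: cvg_near_cst; exists n => // m /= nm.
rewrite (big_cat_nat _ nm)//= [X in _ + X]big_nat_cond [X in _ + X]big1 ?addr0.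
  by apply: eq_big_nat => i /andP[_ ni]; rewrite /G ni.
move=> i /andP[/andP[ni _] _]; rewrite /G ltnNge ni/=.
exact: complex_measure_set0.
Qed.

End ComplexMeasures.

(** * Linearity of completely positive maps *)

Section CompletelyPositiveMaps.
Context {R : realType} {A : cstarAlgType R} {H : hilbertType R}.
Variables (phi : A -> H -> H) (phi_cp : completely_positive phi).

Lemma cpZ c a k : phi (c *: a) k = c *: phi a k.
Proof. by case: phi_cp => _ phi_lin _; rewrite (scalable_linear phi_lin). Qed.

Lemma cp_opB a u v : phi a (u - v) = phi a u - phi a v.
Proof.
by case: phi_cp => /(_ a) [op_lin _] _ _; rewrite (zmod_morphism_linear op_lin).
Qed.

Lemma cp_opZ c a k : phi a (c *: k) = c *: phi a k.
Proof.
by case: phi_cp => /(_ a) [op_lin _] _ _; rewrite (scalable_linear op_lin).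
Qed.

End CompletelyPositiveMaps.

(** * Pointwise bounds from the total variation *)

Section TotalVariation.
Context {R : realType} {X : Type} {OX : set (set X)}.
Context {A : cstarAlgType R} {H : hilbertType R}.
Implicit Types (I J : cp_instrument OX A H).

Lemma le_dual_norm (f : A -> R[i]) (e : R) a :
  (dual_norm f <= e%:E)%E -> `|a| <= 1 -> `|f a| <= e%:C%C.
Proof.
move=> fe a1; rewrite normc_def lecR.
have /le_trans/(_ fe) : ((Normc.normc (f a))%:E <= dual_norm f)%E.
  by apply: ereal_sup_ubound; exists a.
by rewrite lee_fin; case: (f a).
Qed.

Lemma dual_norm_le (f : A -> R[i]) (e : R) :
  (forall a, `|a| <= 1 -> `|f a| <= e%:C%C) -> (dual_norm f <= e%:E)%E.
Proof.
move=> fe; apply: ge_ereal_sup => _ [a a1 <-].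
rewrite lee_fin -lecR; apply: le_trans (fe a a1).
by rewrite normc_def; case: (f a).
Qed.

Lemma dual_norm_ge0 (f : A -> R[i]) : (0 <= dual_norm f)%E.
Proof.
apply: (@le_trans _ _ (Normc.normc (f 0))%:E).
  by rewrite lee_fin; case: (f 0) => x y; exact: sqrtr_ge0.
by apply: ereal_sup_ubound; exists 0 => //=; rewrite normr0.
Qed.

(** One set alone is completed to a partition of X by its complement, except
    when that complement is empty, as the blocks of a partition are nonempty. *)
Lemma dual_norm_le_total_variation (sigmaOX : sigma_algebra setT OX)
    (mu : OX -> A -> R[i]) (E : OX) :
  \val E !=set0 -> (dual_norm (mu E) <= total_variation mu setT)%E.
Proof.
have [_ OC _] := sigmaOX.
move=> E0; have OE : OX (~` \val E).
  by rewrite -setTD; apply: OC; exact/set_mem/valP.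
pose E' : OX := SigSub (mem_set OE).
have [ET|/set0P E'0] := eqVneq (\val E') set0.
  apply: ereal_sup_ubound; exists 1%N, (fun=> E).
  split; last by rewrite big_ord1.
  split=> //; last by move=> i j _ _ _; rewrite (ord1 i) (ord1 j).
  rewrite coverE; apply/seteqP; split=> // x _; exists ord0 => //.
  by apply: contrapT => xE; have xE' : (\val E') x by []; rewrite ET in xE'.
apply: (@le_trans _ _ (dual_norm (mu E) + dual_norm (mu E'))%E).
  by rewrite leeDl// dual_norm_ge0.
apply: ereal_sup_ubound.
exists 2%N, (fun i : 'I_2 => if i == ord0 then E else E'); split; last first.
  by rewrite !big_ord_recl big_ord0 adde0.
split.
- rewrite coverE; apply/seteqP; split=> // x _.
  by have [xE|xE] := pselect (\val E x); [exists ord0|exists ord_max].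
- apply/trivIsetP => i j _ _; case: ifPn => i0; case: ifPn => j0.
  + by rewrite (eqP i0) (eqP j0) eqxx.
  + by rewrite /= setICr.
  + by rewrite /= setICl.
  + have ord1 (l : 'I_2) : l != ord0 -> l = ord_max.
      by move=> l0; apply/val_inj; case: l l0 => [[|[|]]].
    by rewrite (ord1 _ i0) (ord1 _ j0) eqxx.
- by move=> i _; case: ifP.
Qed.

Lemma total_variation_le_tv_norm (D : OX -> A -> H -> H) h k :
  `|h| = 1 -> `|k| = 1 ->
  (total_variation (matrix_coef D h k) setT <= tv_norm D)%E.
Proof.
move=> h1 k1; rewrite le_max; apply/orP; right; apply: ereal_sup_ubound.
by exists h => //; exists k.
Qed.

(** The total variation distance controls all evaluations at once; uniformity
    in `E` is what later makes the limit countably additive. *)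
Lemma normr_le_tv_dist (sigmaOX : sigma_algebra setT OX) I J (e : R) E a k :
  (tv_dist I J <= e%:E)%E -> `|I E a k - J E a k| <= e%:C%C * (`|a| * `|k|).
Proof.
move=> IJe.
have e0 : 0 <= e by rewrite -lee_fin (le_trans _ IJe)// le_max lexx.
have ec0 : (0 : R[i]) <= e%:C%C by rewrite lecR.
(* Both sides are homogeneous in `a` and in `k`. *)
have [->|a0] := eqVneq a 0.
  rewrite -(scale0r (0 : A)) !(cpZ (instrument_cp _ _)) !scale0r subrr.
  by rewrite !normr0 mul0r mulr0.
have [->|k0] := eqVneq k 0.
  rewrite -(scale0r (0 : H)) !(cp_opZ (instrument_cp _ _)) !scale0r subrr.
  by rewrite normr0 !mulr0.
(* The empty set lies in no partition, but there both instruments vanish. *)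
have [E0|/set0P E0] := eqVneq (\val E) set0.
  apply: normr_le_inner => [|h _]; first by rewrite !mulr_ge0.
  rewrite innerB.
  rewrite (complex_measure_set0 (@instrument_measure _ _ _ _ _ I h k a) E0).
  rewrite (complex_measure_set0 (@instrument_measure _ _ _ _ _ J h k a) E0).
  by rewrite subrr normr0 !mulr_ge0.
pose a' := `|a|^-1 *: a; pose k' := `|k|^-1 *: k.
have a1 : `|a'| = 1 by rewrite normrZ normfV normr_id mulVf// normr_eq0.
have k1 : `|k'| = 1 by rewrite normrZ normfV normr_id mulVf// normr_eq0.
have aE : a = `|a| *: a' by rewrite scalerA divff ?scale1r// normr_eq0.
have kE : k = `|k| *: k' by rewrite scalerA divff ?scale1r// normr_eq0.
clearbody a' k'; rewrite {1 2}aE {1 2}kE.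
rewrite !(cpZ (instrument_cp _ _)) !(cp_opZ (instrument_cp _ _)).
rewrite -!scalerBr !normrZ !normr_id mulrA [leRHS]mulrC.
rewrite ler_wpM2l// ?mulr_ge0//.
apply: normr_le_inner => // h h1.
apply: (@le_dual_norm (matrix_coef (fun E a h => I E a h - J E a h) h k' E)).
  apply: (le_trans (dual_norm_le_total_variation sigmaOX _ E0)).
  exact: le_trans (total_variation_le_tv_norm _ h1 k1) IJe.
by rewrite a1.
Qed.

End TotalVariation.

(** * The limit of a Cauchy filter of instruments *)

Section CauchyFilter.
Context {R : realType} {X : Type} {OX : set (set X)}.
Hypothesis sigmaOX : sigma_algebra setT OX.
Context {A : cstarAlgType R} {H : hilbertType R}.
Variable (F : set_system (cp_instrument OX A H)).
Context {FF : ProperFilter F}.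
Hypothesis F_cauchy : cauchy F.
Local Notation ins := (cp_instrument OX A H).
Implicit Types (I J : ins).

Lemma near_tv_dist (e : R) : 0 < e ->
  \forall I \near F, \forall J \near F, (tv_dist I J <= e%:E)%E.
Proof.
move=> e0; have /cauchy_ballP/(_ e e0)/nearP_dep := F_cauchy.
by apply: filterS => I; apply: filterS => J /ltW.
Qed.

(* The cast gives the filter `F` its type: without it `I` ranges over bare
   functions. *)
Definition limit_map E a k : H := lim ((I : ins) E a k @[I --> F]).

Lemma cvg_limit_map E a k :
  (I : ins) E a k @[I --> F] --> limit_map E a k.
Proof.
apply: cauchy_cvg; apply: cauchy_exP => /= e e0.
have e20 : 0 < e / 2 by rewrite divr_gt0.
have [d d0 de] := ex_real_radius e20 (mulr_ge0 (normr_ge0 a) (normr_ge0 k)).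
have /filter_ex[I FI] := near_tv_dist d0.
exists (I E a k); apply: filterS FI => J IJ.
rewrite -ball_normE /ball_ /=.
apply: (le_lt_trans (normr_le_tv_dist sigmaOX E a k IJ)).
by apply: (le_lt_trans de); rewrite ltr_pdivrMr// ltr_pMr// ltr1n.
Qed.

Lemma normr_limit_map_le I (e : R) E a k :
  (\forall J \near F, (tv_dist I J <= e%:E)%E) ->
  `|I E a k - limit_map E a k| <= e%:C%C * (`|a| * `|k|).
Proof.
move=> FI; rewrite -subr_ge0.
apply: (@cvg_ge0_complex R _ F _
  (fun J : ins => e%:C%C * (`|a| * `|k|) - `|I E a k - J E a k|)).
  by apply: filterS FI => J IJ; rewrite subr_ge0 normr_le_tv_dist.
apply: cvgB; first exact: cvg_cst.
apply: (@cvg_norm _ H); apply: cvgB; [exact: cvg_cst|exact: cvg_limit_map].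
Qed.

Lemma near_limit_map (e : R) : 0 < e -> \forall J \near F,
  forall E a k,
    `|(J : ins) E a k - limit_map E a k| <= e%:C%C * (`|a| * `|k|).
Proof.
move=> /near_tv_dist; apply: filterS => J FJ E a k.
exact: normr_limit_map_le.
Qed.

(** `limit_map E a` is continuous because it differs from the continuous `I E a`
    by a linear map that is bounded, for one `I` at distance at most 1. *)
Lemma limit_map_bounded_op E a : bounded_op (limit_map E a).
Proof.
have Llin : linear (limit_map E a).
  move=> c u v; apply: (cvg_unique (@norm_hausdorff _ _) (@cvg_limit_map E a _)).
  rewrite (_ : (fun I : ins => I E a (c *: u + v)) =
      fun I : ins => c *: I E a u + I E a v).
    by apply: cvgD; [apply: cvgZ; first exact: cvg_cst|]; exact: cvg_limit_map.
  by apply/funext => I; have [/(_ a)[->]] := instrument_cp I E.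
split=> // x; have /filter_ex[I LI] := near_limit_map ltr01.
have -> : limit_map E a = (fun y => I E a y - (I E a y - limit_map E a y)).
  by apply/funext => y; rewrite opprB addrC subrK.
apply: cvgB.
  by have [/(_ a)[_ cont_I] _ _] := instrument_cp I E; exact: cont_I.
apply: (@cvg_le_dist R[i] H H _ _ _ id _ x _ `|a|) => // y.
have := LI E a (x - y).
rewrite (cp_opB (instrument_cp I E)) (zmod_morphism_linear Llin) mul1r.
by rewrite !opprB addrACA [- _ - _]addrC addrACA.
Qed.

Lemma limit_map_cp E : completely_positive (limit_map E).
Proof.
split=> [a||n M M0 h]; first exact: limit_map_bounded_op.
- move=> c a b; apply/funext => k.
  apply: (cvg_unique (@norm_hausdorff _ _) (@cvg_limit_map E _ k)).
  rewrite (_ : (fun I : ins => I E (c *: a + b) k) =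
      fun I : ins => c *: I E a k + I E b k).
    by apply: cvgD; [apply: cvgZ; first exact: cvg_cst|]; exact: cvg_limit_map.
  by apply/funext => I; have [_ -> _] := instrument_cp I E.
- apply: (@cvg_ge0_complex R _ F _
    (fun I : ins => \sum_i \sum_j inner (h i) (I E (M i j) (h j)))).
    by apply: nearW => I; have [_ _ /(_ n M M0 h)] := instrument_cp I E.
  apply: cvg_big => [|i _]; first exact: add_continuous.
  apply: cvg_big => [|j _]; first exact: add_continuous.
  by apply: cvg_inner; exact: cvg_limit_map.
Qed.

(** A uniform limit of measures is a measure: the value on `U` and the partial
    sum, which is the value on a finite union `V`, are compared through one
    instrument `I` close to the limit on both sets. *)
Lemma limit_map_measure h k a :
  complex_measure (fun E => inner h (limit_map E a k)).
Proof.
move=> G U tG UG.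
have sumG n : exists2 V : OX,
    \sum_(0 <= i < n) inner h (limit_map (G i) a k) = inner h (limit_map V a k) &
    forall I, \sum_(0 <= i < n) inner h ((I : ins) (G i) a k) = inner h (I V a k).
  have [V _ VG] := @complex_measure_finite_union R X OX sigmaOX G n.
  have IV (I : ins) :
      \sum_(0 <= i < n) inner h (I (G i) a k) = inner h (I V a k).
    by rewrite -(VG (fun E => inner h (I E a k)))//; exact: instrument_measure.
  exists V => //.
  have LV : inner h ((I : ins) V a k) @[I --> F] -->
      (inner h (limit_map V a k) : R[i]^o).
    by apply: cvg_inner; exact: cvg_limit_map.
  have LS : (inner h ((I : ins) V a k) : R[i]^o) @[I --> F]
      --> (\sum_(0 <= i < n) inner h (limit_map (G i) a k) : R[i]^o).
    under eq_fun do rewrite -IV.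
    apply: cvg_big => [|i _]; first exact: add_continuous.
    by apply: cvg_inner; exact: cvg_limit_map.
  exact: (cvg_unique (@norm_hausdorff _ _) LS LV).
apply/cvgrPdist_le => e e0.
have e30 : 0 < e / 3 by rewrite divr_gt0.
have c0 : 0 <= `|h| * (`|a| * `|k|) by rewrite !mulr_ge0.
have [d d0 de] := ex_real_radius e30 c0.
have /filter_ex[I LI] := near_limit_map d0.
have LIh E : `|inner h (I E a k) - inner h (limit_map E a k)| <= e / 3.
  rewrite -innerB; apply: (le_trans (normr_inner_le _ _)).
  by apply: le_trans de; rewrite mulrCA ler_wpM2l.
have := @instrument_measure _ _ _ _ _ I h k a G U tG UG.
move/cvgrPdist_le => /(_ _ e30).
apply: filterS => n; have [V -> ->] := sumG n => IUV.
rewrite (_ : _ - _ = - (inner h (I U a k) - inner h (limit_map U a k)) +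
  (inner h (I U a k) - inner h (I V a k)) +
  (inner h (I V a k) - inner h (limit_map V a k))); last by ring.
rewrite (_ : e = e / 3 + e / 3 + e / 3); last by field.
apply: (le_trans (ler_normD _ _)); apply: lerD => //.
by apply: (le_trans (ler_normD _ _)); rewrite normrN; apply: lerD.
Qed.

Definition limit_instrument : ins :=
  CPInstrument limit_map_cp limit_map_measure.

(** Lower semicontinuity of the total variation distance under the pointwise
    convergence, which is uniform over the sets of a partition. *)
Lemma tv_dist_limit_le I (e : R) :
  (\forall J \near F, (tv_dist I J <= e%:E)%E) ->
  (tv_dist I limit_instrument <= e%:E)%E.
Proof.
move=> FI; have /filter_ex[J0 IJ0] := FI.
have e0 : (0 <= e%:E)%E by rewrite (le_trans _ IJ0)// le_max lexx.
rewrite ge_max e0/=; apply: ge_ereal_sup => _ [h /= h1 [k /= k1 <-]].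
apply: ge_ereal_sup => _ [n [E [EX ->]]].
apply/lee_addgt0Pr => d d0.
(* Each of the `n` blocks may cost `d / (n + 1)`. *)
have d0' : 0 < d / n.+1%:R by rewrite divr_gt0.
have [J [IJ LJ]] := filter_ex (filterI FI (near_limit_map d0')).
apply: (@le_trans _ _ (\sum_(i < n)
    (dual_norm (matrix_coef (fun E a h => I E a h - J E a h)%R h k (E i)) +
     (d / n.+1%:R)%:E))%E).
  apply: lee_sum => i _.
  have -> : matrix_coef (fun E a h => I E a h - limit_map E a h) h k (E i) =
      (fun a => matrix_coef (fun E a h => I E a h - J E a h) h k (E i) a +
        matrix_coef (fun E a h => J E a h - limit_map E a h) h k (E i) a).
    by apply/funext => a; rewrite /matrix_coef -innerD addrA subrK.
  apply: (le_trans (dual_norm_add _ _)); apply: leeD => //.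
  apply: dual_norm_le => a a1; apply: (le_trans (normr_inner_le _ _)).
  rewrite h1 mul1r; apply: (le_trans (LJ _ _ _)).
  by rewrite k1 mulr1 ler_piMr// lecR ltW.
rewrite big_split/=; apply: leeD.
  apply: le_trans IJ; apply: le_trans (total_variation_le_tv_norm _ h1 k1).
  by apply: ereal_sup_ubound; exists n, E.
rewrite sumEFin lee_fin sumr_const card_ord -(mulr_natr (d / _)).
by rewrite mulrAC ler_pdivrMr// ler_wpM2l ?ler_nat ?(ltW d0).
Qed.

End CauchyFilter.

Theorem theorem3p11 (R : realType) (X : Type) (OX : set (set X))
    (sigmaOX : sigma_algebra setT OX) (A : cstarAlgType R) (H : hilbertType R)
    (F : set_system (cp_instrument OX A H)) :
  ProperFilter F -> cauchy F -> cvg F.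
Proof.
move=> FF F_cauchy.
apply: (cvgP (limit_instrument sigmaOX F_cauchy)).
apply/(cvg_ballP id) => e e0.
have e20 : 0 < e / 2 by rewrite divr_gt0.
apply: filterS (near_tv_dist F_cauchy e20) => I FI.
apply: tv_ball_sym; rewrite /tv_ball/=.
apply: (le_lt_trans (tv_dist_limit_le sigmaOX F_cauchy FI)).
by rewrite lte_fin ltr_pdivrMr// ltr_pMr// ltr1n.
Qed.
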